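(* For $\gamma,\omega\in\mathbb R$ let $\sigma_{\gamma,\omega}$ be the spectrum of $Q_{\gamma,\omega}$. For all $\gamma,\omega\in\mathbb R$, $$\sigma_{\gamma,\omega+\frac\pi4}=\sigma_{\gamma-6\pi,\omega},\qquad \sigma_{\gamma,-\omega}=\sigma_{-\gamma,\omega}.$$ Thus it is enough to consider $\omega\in[0,\pi/8]$ to obtain all the spectra: for all $\gamma,\omega\in\mathbb R$ there are $\gamma'\in\mathbb R$ and $\omega'\in[0,\pi/8]$ with $\sigma_{\gamma,\omega}=\sigma_{\gamma',\omega'}$.
   Context: On $\ell^2(\mathbb Z^2;\mathbb C)$ let $(\tau_1v)_\alpha=v_{\alpha_1-1,\alpha_2}$, $(\tau_2v)_\alpha=e^{i\gamma\alpha_1}v_{\alpha_1,\alpha_2-1}$, $\alpha=(\alpha_1,\alpha_2)\in\mathbb Z^2$. For $\gamma,\omega\in\mathbb R$, acting on $\ell^2(\mathbb Z^2;\mathbb C^3)$, $$Q_{\gamma,\omega}=\begin{pmatrix}0&e^{i(\omega+\frac\gamma8)}(\tau_1^*+e^{-i\frac\gamma2}\tau_1^*\tau_2)&e^{-i(\omega+\frac\gamma8)}(\tau_1^*+\tau_2^* )\\ e^{-i(\omega+\frac\gamma8)}(\tau_1+e^{-i\frac\gamma2}\tau_1\tau_2^* )&0&e^{i(\omega+\frac\gamma8)}(e^{-i\frac\gamma2}\tau_1\tau_2^*+\tau_2^* )\\ e^{i(\omega+\frac\gamma8)}(\tau_1+\tau_2)&e^{-i(\omega+\frac\gamma8)}(e^{-i\frac\gamma2}\tau_1^*\tau_2+\tau_2)&0\end{pmatrix}.$$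 *)

(* Defs.v *)
From HB Require Import structures.
From mathcomp Require Import all_boot all_order all_algebra.
From mathcomp Require Import all_classical all_reals all_analysis.
From mathcomp Require Import complex ring lra.

Set Warnings "-notation-overridden".
Set Implicit Arguments.
Unset Strict Implicit.
Unset Printing Implicit Defensive.

Import Order.TTheory GRing.Theory Num.Theory.
Import numFieldNormedType.Exports.

Local Open Scope classical_set_scope.
Local Open Scope ring_scope.

(* No condition on the way [T v - l *: v] fails to be boundedly invertible:
   point, continuous and residual spectrum are all included. *)
Definition resolvent_set (K : numFieldType) (V : normedModType K)
    (T : {linear V -> V}) : set K :=
  [set l | exists S : {linear V -> V},
    [/\ continuous S,
        forall v, S (T v - l *: v) = v &
        forall v, T (S v) - l *: S v = v]].

Definition spectrum (K : numFieldType) (V : normedModType K)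
    (T : {linear V -> V}) : set K := ~` resolvent_set T.

Section SquaredModulus.
Variable R : realType.
Implicit Types y z : R[i].

Definition sqmod (z : R[i]) : R := complex.Re z ^+ 2 + complex.Im z ^+ 2.

Lemma sqmod_ge0 z : 0 <= sqmod z.
Proof. by rewrite addr_ge0 ?sqr_ge0. Qed.

Lemma sqmod0 : sqmod 0 = 0.
Proof. by rewrite /sqmod/= expr0n addr0. Qed.

Lemma sqmod1 : sqmod 1 = 1.
Proof. by rewrite /sqmod/= expr1n expr0n addr0. Qed.

Lemma sqmodM y z : sqmod (y * z) = sqmod y * sqmod z.
Proof. by case: y z => [a b] [c d]; rewrite /sqmod/=; ring. Qed.

Lemma sqmodD (t : R) y z : 0 < t ->
  sqmod (y + z) <= (1 + t) * sqmod y + (1 + t^-1) * sqmod z.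
Proof.
have key (a b : R) : 0 < t -> (a + b) ^+ 2 <= (1 + t) * a ^+ 2 + (1 + t^-1) * b ^+ 2.
  move=> t0; rewrite -subr_ge0.
  have -> : (1 + t) * a ^+ 2 + (1 + t^-1) * b ^+ 2 - (a + b) ^+ 2
      = t^-1 * (t * a - b) ^+ 2 by field; rewrite gt_eqF.
  by rewrite mulr_ge0 ?sqr_ge0// invr_ge0 ltW.
case: y z => [a b] [c d] t0; rewrite /sqmod/= !mulrDr addrACA.
by rewrite lerD ?key.
Qed.

End SquaredModulus.

Section SquareSummable.
Variables (R : realType) (I : choiceType).
Implicit Types v w : I -> R[i].

Definition sumsq v : \bar R := \esum_(i in setT) (sqmod (v i))%:E.

Lemma sumsq_ge0 v : (0 <= sumsq v)%E.
Proof. by apply: esum_ge0 => i _; rewrite lee_fin sqmod_ge0. Qed.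

Lemma esumZl (c : R) (f : I -> \bar R) : 0 <= c -> (forall i, (0 <= f i)%E) ->
  \esum_(i in [set: I]) (c%:E * f i)%E = (c%:E * \esum_(i in [set: I]) f i)%E.
Proof.
have le (d : R) (g : I -> \bar R) : 0 <= d -> (forall i, (0 <= g i)%E) ->
    (\esum_(i in [set: I]) (d%:E * g i) <= d%:E * \esum_(i in [set: I]) g i)%E.
  move=> d0 g0; apply: ge_ereal_sup => _ [A [finA _] <-].
  rewrite -ge0_mule_fsumr//; apply: lee_wpmul2l; rewrite ?lee_fin//.
  by apply: ereal_sup_ubound; exists A.
move=> c0 f0; apply/eqP; rewrite eq_le le//=.
have := c0; rewrite [0 <= c]le_eqVlt => /predU1P[<-|{}c0].
  by rewrite mul0e; apply: esum_ge0 => i _; rewrite mul0e.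
rewrite -lee_pdivlMl//; under eq_esum.
  move=> i _; rewrite -[f i]mul1e -[1%R](mulVf (lt0r_neq0 c0)) EFinM -muleA.
  over.
by apply: le => [|i]; rewrite ?invr_ge0 ?mule_ge0// ?lee_fin ltW.
Qed.

Lemma sumsqZ c v : sumsq (fun i => c * v i) = ((sqmod c)%:E * sumsq v)%E.
Proof.
rewrite -esumZl ?sqmod_ge0//; last by move=> i; rewrite lee_fin sqmod_ge0.
by apply: eq_esum => i _; rewrite sqmodM EFinM.
Qed.

Lemma sumsqD (t : R) v w : 0 < t ->
  (sumsq (fun i => v i + w i)%R <=
   (1 + t)%:E * sumsq v + (1 + t^-1)%:E * sumsq w)%E.
Proof.
move=> t0; have t1 : 0 <= 1 + t by rewrite addr_ge0 ?ltW.
have t2 : 0 <= 1 + t^-1 by rewrite addr_ge0 ?invr_ge0 ?ltW.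
rewrite -!esumZl//; try by move=> i; rewrite lee_fin sqmod_ge0.
rewrite -esumD; try by move=> i _; rewrite mule_ge0 ?lee_fin ?sqmod_ge0.
by apply: le_esum => i _; rewrite -!EFinM -EFinD lee_fin sqmodD.
Qed.

Definition square_summable : {pred I -> R[i]} :=
  fun v => `[< (sumsq v < +oo)%E >].

Lemma square_summableE v : (v \in square_summable) = (sumsq v < +oo)%E.
Proof. by rewrite unfold_in /square_summable asboolb. Qed.

Lemma square_summable_submod : submod_closed square_summable.
Proof.
have sum0 : sumsq (fun=> 0) = 0%E by apply: esum1 => i _; rewrite sqmod0.
split=> [|c v w]; rewrite !square_summableE ?sum0// => vfin wfin.
apply: le_lt_trans (sumsqD (fun i => c * v i) w ltr01) _.
by rewrite sumsqZ !lte_add_pinfty// !lte_mul_pinfty ?mule_ge0 ?sumsq_ge0// ?lee_fin ?sqmod_ge0 ?addr_ge0 ?invr_ge0 ?lte_mul_pinfty ?lee_fin ?sqmod_ge0.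
Qed.

HB.instance Definition _ :=
  GRing.isSubmodClosed.Build R[i] (I -> R[i]) square_summable
    square_summable_submod.

Record l2 := MkL2 { l2fun :> I -> R[i]; l2P : l2fun \in square_summable }.

HB.instance Definition _ := [isSub for l2fun].
HB.instance Definition _ := [Choice of l2 by <:].
HB.instance Definition _ := [SubChoice_isSubLmodule of l2 by <:].

End SquareSummable.

Section L2Norm.
Variables (R : realType) (I : choiceType).
Implicit Types v w : l2 R I.

Lemma l2_ext v w : (forall i, v i = w i) -> v = w.
Proof. by move=> vw; apply/val_inj/funext. Qed.

Lemma l2D v w i : (v + w) i = v i + w i. Proof. by []. Qed.

Lemma l2Z c v i : (c *: v) i = c * v i. Proof. by []. Qed.

Definition l2norm v : R := Num.sqrt (fine (sumsq v)).

Lemma sumsq_fin v : sumsq v \is a fin_num.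
Proof. by rewrite ge0_fin_numE ?sumsq_ge0// -square_summableE l2P. Qed.

Lemma l2norm_ge0 v : 0 <= l2norm v. Proof. exact: sqrtr_ge0. Qed.

Lemma sqr_l2norm v : (l2norm v ^+ 2)%:E = sumsq v.
Proof. by rewrite sqr_sqrtr ?fine_ge0 ?sumsq_ge0// fineK ?sumsq_fin. Qed.

Lemma l2norm_eq0 v : l2norm v = 0 -> v = 0.
Proof.
move=> v0; have s0 : sumsq v = 0%E by rewrite -sqr_l2norm v0 expr0n.
apply: l2_ext => i; have : ((sqmod (v i))%:E <= sumsq v)%E.
  rewrite -(@esum_set1 _ _ i (fun j => (sqmod (v j))%:E)) ?lee_fin ?sqmod_ge0//.
  by rewrite /sumsq esum_mkcond; apply: le_esum => j _; case: ifP => // _;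
    rewrite lee_fin sqmod_ge0.
rewrite s0 lee_fin; case: (v i) => a b; rewrite /sqmod/= => ab0.
have : a ^+ 2 + b ^+ 2 == 0 by rewrite eq_le ab0 addr_ge0 ?sqr_ge0.
by rewrite paddr_eq0 ?sqr_ge0// !sqrf_eq0 => /andP[/eqP-> /eqP->].
Qed.

Lemma l2normD v w : l2norm (v + w) <= l2norm v + l2norm w.
Proof.
have [/eqP/l2norm_eq0->|v0] := boolP (l2norm v == 0).
  by rewrite add0r lerDr l2norm_ge0.
have [/eqP/l2norm_eq0->|w0] := boolP (l2norm w == 0).
  by rewrite addr0 lerDl l2norm_ge0.
have vp : 0 < l2norm v by rewrite lt_neqAle eq_sym v0 l2norm_ge0.
have wp : 0 < l2norm w by rewrite lt_neqAle eq_sym w0 l2norm_ge0.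
rewrite -ler_sqr ?nnegrE ?addr_ge0 ?l2norm_ge0//.
have := sumsqD v w (divr_gt0 wp vp); rewrite -[X in (X <= _)%E]/(sumsq (v + w)).
rewrite -!sqr_l2norm -!EFinM -EFinD lee_fin => /le_trans; apply.
by rewrite le_eqVlt; apply/orP; left; apply/eqP; field; rewrite v0.
Qed.

Lemma sqmodE (z : R[i]) : (sqmod z)%:C%C = `|z| ^+ 2.
Proof. exact: add_Re2_Im2. Qed.

Lemma l2normZ c v : (l2norm (c *: v))%:C%C = `|c| * (l2norm v)%:C%C.
Proof.
have -> : `|c| = (Num.sqrt (sqmod c))%:C%C by rewrite normc_def.
rewrite -rmorphM -sqrtrM ?sqmod_ge0//; congr ((Num.sqrt _)%:C%C).
by rewrite (sumsqZ c v) fineM ?sumsq_fin.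
Qed.

Lemma l2normCD v w :
  (l2norm (v + w))%:C%C <= (l2norm v)%:C%C + (l2norm w)%:C%C.
Proof. by rewrite -rmorphD lecR l2normD. Qed.

Lemma l2normC_eq0 v : (l2norm v)%:C%C = 0 -> v = 0.
Proof. by case=> /l2norm_eq0. Qed.

HB.instance Definition _ := isPointed.Build (l2 R I) 0.
HB.instance Definition _ :=
  Lmodule_isNormed.Build R[i] (l2 R I) l2normCD l2normZ l2normC_eq0.

Lemma l2_normE v : `|v| = (l2norm v)%:C%C. Proof. by []. Qed.

End L2Norm.

Section InnerProduct.
Variables (R : realType) (I : choiceType).

(* Junk unless [f] is absolutely summable, which it is in [l2dot]. *)
Definition real_sum (f : I -> R) : R :=
  fine (\esum_(i in setT) (Num.max (f i) 0)%:E) -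
  fine (\esum_(i in setT) (Num.max (- f i) 0)%:E).

Definition l2dot (v w : l2 R I) : R[i] :=
  (real_sum (fun i => complex.Re (v i * (w i)^*%C)) +i*
   real_sum (fun i => complex.Im (v i * (w i)^*%C)))%C.

Definition is_adjoint (T S : l2 R I -> l2 R I) :=
  forall v w, l2dot (T v) w = l2dot v (S w).

Lemma real_sum_reindex (s : I -> I) f :
  bijective s -> real_sum (f \o s) = real_sum f.
Proof.
move=> bij_s; have bs : set_bij setT setT s by rewrite setTT_bijective.
congr (fine _ - fine _); apply/esym => /=.
  exact: (@reindex_esum _ _ _ _ _ _ (fun i => (Num.max (f i) 0)%:E) bs).
exact: (@reindex_esum _ _ _ _ _ _ (fun i => (Num.max (- f i) 0)%:E) bs).
Qed.

Lemma is_adjoint_reindex (T S : l2 R I -> l2 R I) (s : I -> I) :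
    bijective s ->
    (forall (v w : l2 R I) i, T v (s i) * (w (s i))^*%C = v i * (S w i)^*%C) ->
  is_adjoint T S.
Proof.
move=> bs TS v w; rewrite /l2dot; congr (Complex _ _).
  rewrite -(real_sum_reindex _ bs); congr real_sum.
  by apply/funext => i /=; rewrite TS.
rewrite -(real_sum_reindex _ bs); congr real_sum.
by apply/funext => i /=; rewrite TS.
Qed.

Lemma sumsq_reindex (u : I -> R[i]) (s : I -> I) (v : I -> R[i]) :
    bijective s -> (forall i, sqmod (u i) = 1) ->
  sumsq (fun i => u i * v (s i)) = sumsq v.
Proof.
move=> bij_s u1; have bs : set_bij setT setT s by rewrite setTT_bijective.
rewrite /sumsq.
rewrite (@reindex_esum _ _ _ _ _ _ (fun i => (sqmod (v i))%:E) bs).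
by apply: eq_esum => i _; rewrite sqmodM u1 mul1r.
Qed.

Lemma reindex_subproof (u : I -> R[i]) (s : I -> I) (v : l2 R I) :
    bijective s -> (forall i, sqmod (u i) = 1) ->
  (fun i => u i * v (s i)) \in @square_summable R I.
Proof.
by move=> bs u1; rewrite square_summableE sumsq_reindex// -square_summableE l2P.
Qed.

End InnerProduct.

(* l^2(I; C^n) is represented by l^2(I * 'I_n; C): the k-th coordinate of the
   value of [v] at [i] is [v (i, k)], and [opmx A] is the n x n matrix [A] of
   operators on l^2(I; C) acting on the column of the components of [v]. *)
Section OperatorMatrix.
Variables (R : realType) (I : choiceType) (n : nat).

Lemma sumsq_components (v : I * 'I_n -> R[i]) :
  sumsq v = (\sum_(k < n) sumsq (fun i => v (i, k)))%E.
Proof.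
rewrite -esum_sum; last by move=> *; rewrite lee_fin sqmod_ge0.
rewrite /sumsq; transitivity
  (\esum_(i in [set: I]) \esum_(k in [set: 'I_n]) (sqmod (v (i, k)))%:E).
  rewrite esum_esum; last by move=> *; rewrite lee_fin sqmod_ge0.
  have -> : [set: I] `*`` (fun=> [set: 'I_n]) = [set: I * 'I_n].
    by apply/seteqP; split.
  by apply: eq_esum => -[].
apply: eq_esum => i _; rewrite esum_fset//; last first.
  by move=> *; rewrite lee_fin sqmod_ge0.
  exact: finite_finset.
rewrite [RHS]fsbig_seq ?index_enum_uniq//; apply: eq_fsbigl.
by apply/seteqP; split=> k //= _; exact: mem_index_enum.
Qed.

Lemma component_subproof (k : 'I_n) (v : l2 R (I * 'I_n)%type) :
  (fun i => v (i, k)) \in @square_summable R I.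
Proof.
have := l2P v; rewrite !square_summableE sumsq_components; apply: le_lt_trans.
by rewrite (bigD1 k)//= leeDl// sume_ge0// => j _; exact: sumsq_ge0.
Qed.

Definition component k v : l2 R I := MkL2 (component_subproof k v).

Lemma assemble_subproof (w : 'I_n -> l2 R I) :
  (fun p : I * 'I_n => w p.2 p.1) \in @square_summable R (I * 'I_n)%type.
Proof.
rewrite square_summableE sumsq_components/=; apply: lte_sum_pinfty => k _.
by rewrite -square_summableE; exact: l2P.
Qed.

Definition assemble w : l2 R (I * 'I_n)%type := MkL2 (assemble_subproof w).

Definition opmx (A : 'M[l2 R I -> l2 R I]_n) (v : l2 R (I * 'I_n)%type) :=
  assemble (fun j => \sum_(k < n) A j k (component k v)).

Lemma opmx_linear (A : 'M[l2 R I -> l2 R I]_n) :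
  (forall j k, linear (A j k)) -> linear (opmx A).
Proof.
move=> lA c v w; apply: l2_ext => -[i j].
rewrite l2D l2Z /opmx/= -l2Z -l2D; congr (l2fun _ i).
rewrite scaler_sumr -big_split/=; apply: eq_bigr => k _.
by rewrite -lA; congr (A j k _); apply: l2_ext.
Qed.

End OperatorMatrix.

Section Model.
Variable R : realType.

Local Notation H := (l2 R (int * int)%type).
Local Notation H3 := (l2 R ((int * int) * 'I_3)%type).

Definition expi (t : R) : R[i] := (cos t +i* sin t)%C.

Lemma sqmod_expi t : sqmod (expi t) = 1.
Proof. exact: cos2Dsin2. Qed.

Lemma conj_expi t : ((expi t)^*)%C = expi (- t).
Proof. by rewrite /expi/= cosN sinN. Qed.

Lemma bij_shift (m n : int) :
  bijective (fun a : int * int => (a.1 + m, a.2 + n)).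
Proof.
exists (fun a => (a.1 - m, a.2 - n)) => -[a b] /=; first by rewrite !addrK.
by rewrite !subrK.
Qed.

Fact weighted_shift_subproof (u : int * int -> R[i]) (m n : int) (v : H) :
    (forall a, sqmod (u a) = 1) ->
  (fun a => u a * v (a.1 + m, a.2 + n)) \in @square_summable R (int * int)%type.
Proof. exact: (reindex_subproof v (bij_shift m n)). Qed.

Fact tau1_subproof (v : H) :
  (fun a => v (a.1 - 1, a.2)) \in @square_summable R (int * int)%type.
Proof.
have := weighted_shift_subproof (-1) 0 v (fun=> sqmod1 R).
by under eq_fun do rewrite mul1r addr0.
Qed.
Definition tau1 v : H := MkL2 (tau1_subproof v).

Fact tau1_adj_subproof (v : H) :
  (fun a => v (a.1 + 1, a.2)) \in @square_summable R (int * int)%type.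
Proof.
have := weighted_shift_subproof 1 0 v (fun=> sqmod1 R).
by under eq_fun do rewrite mul1r addr0.
Qed.
Definition tau1_adj v : H := MkL2 (tau1_adj_subproof v).

Fact tau2_subproof (g : R) (v : H) :
  (fun a => expi (g * a.1%:~R) * v (a.1, a.2 - 1))
    \in @square_summable R (int * int)%type.
Proof.
have := weighted_shift_subproof 0 (-1) v (fun a => sqmod_expi (g * a.1%:~R)).
by under eq_fun do rewrite addr0.
Qed.
Definition tau2 g v : H := MkL2 (tau2_subproof g v).

Fact tau2_adj_subproof (g : R) (v : H) :
  (fun a => expi (- (g * a.1%:~R)) * v (a.1, a.2 + 1))
    \in @square_summable R (int * int)%type.
Proof.
have := weighted_shift_subproof 0 1 v (fun a => sqmod_expi (- (g * a.1%:~R))).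
by under eq_fun do rewrite addr0.
Qed.
Definition tau2_adj g v : H := MkL2 (tau2_adj_subproof g v).

Lemma tau1_adjP : is_adjoint tau1 tau1_adj.
Proof.
apply: (is_adjoint_reindex (bij_shift 1 0)) => v w [a b].
by rewrite /= addr0 addrK.
Qed.

Lemma tau2_adjP g : is_adjoint (tau2 g) (tau2_adj g).
Proof.
apply: (is_adjoint_reindex (bij_shift 0 1)) => v w [a b].
rewrite /= addr0 addrK rmorphM mulrA; congr (_ * _).
by rewrite [RHS]mulrC; congr (_ * _); rewrite -[RHS]/((expi _)^*%C) conj_expi opprK.
Qed.

Lemma tau1_linear : linear tau1.
Proof. by move=> c v w; apply: l2_ext. Qed.

Lemma tau1_adj_linear : linear tau1_adj.
Proof. by move=> c v w; apply: l2_ext. Qed.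

Lemma tau2_linear g : linear (tau2 g).
Proof.
by move=> c v w; apply: l2_ext => a; rewrite l2D l2Z /= mulrDr mulrCA.
Qed.

Lemma tau2_adj_linear g : linear (tau2_adj g).
Proof.
by move=> c v w; apply: l2_ext => a; rewrite l2D l2Z /= mulrDr mulrCA.
Qed.

(* [g] and [w] stand for gamma and omega. *)
Definition Qmx (g w : R) : 'M[H -> H]_3 :=
  let p := expi (w + g / 8) in
  let m := expi (- (w + g / 8)) in
  let c := expi (- (g / 2)) in
  let t1 := tau1 in let t1' := tau1_adj in
  let t2 := tau2 g in let t2' := tau2_adj g in
  \matrix_(j, k) nth 0 (nth [::]
   [:: [:: 0; p *: (t1' + c *: (t1' \o t2)); m *: (t1' + t2')];
       [:: m *: (t1 + c *: (t1 \o t2')); 0; p *: (c *: (t1 \o t2') + t2')];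
       [:: p *: (t1 + t2); m *: (c *: (t1' \o t2) + t2); 0]] j) k.

Fact Qmx_linear g w j k : linear (Qmx g w j k).
Proof.
have linD (f h : H -> H) : linear f -> linear h -> linear (f + h).
  by move=> lf lh c x y; rewrite !addrfctE lf lh scalerDr addrACA.
have linZ (d : R[i]) (f : H -> H) : linear f -> linear (d *: f).
  by move=> lf c x y; rewrite !scalrfctE lf scalerDr !scalerA mulrC.
have lin0 : linear (0 : H -> H) by move=> c x y; rewrite scaler0 addr0.
have [l1 l1'] := (tau1_linear, tau1_adj_linear).
have [l2 l2'] := (tau2_linear g, tau2_adj_linear g).
have l12 : linear (tau1_adj \o tau2 g) by move=> c x y /=; rewrite l2 l1'.
have l21 : linear (tau1 \o tau2_adj g) by move=> c x y /=; rewrite l2' l1.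
rewrite mxE; case: j k => [[|[|[|//]]] ?] [[|[|[|//]]] ?] /=;
  do ?[exact: lin0 | assumption | apply: (linZ) | apply: (linD)].
Qed.

HB.instance Definition _ g w := GRing.isLinear.Build R[i] H3 H3 _
  (opmx (Qmx g w)) (opmx_linear (@Qmx_linear g w)).

Definition Q (g w : R) : {linear H3 -> H3} := opmx (Qmx g w).

Definition sigma (g w : R) : set R[i] := @spectrum R[i] H3 (Q g w).

End Model.

(* Main.v *)
(* Both identities come from unitary equivalences given by a weighted permutation
   of the lattice sites.
   - Multiplication by (-1)^(a + b) at the site (a, b) changes the signs of tau_1
     and tau_2.  On the other side, gamma - 6 pi leaves e^(i gamma a) unchanged
     and changes the signs of e^(-i gamma/2) and of e^(i(omega + gamma/8))
     relative to omega + pi/4, so the two operators agree.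
   - The reflection (a, b) |-> (-a, a + b) of the kagome lattice, which exchanges
     the first two components of C^3, reverses all fluxes; the weight
     e^(i gamma a^2/2) restores the Landau gauge.  Being linear, this avoids
     complex conjugation, which would need the reality of the spectrum.
   Reducing omega modulo pi/4 to [-pi/8, pi/8] and then flipping its sign leaves
   [0, pi/8]. *)

From HB Require Import structures.
Require Import Defs.
From mathcomp Require Import all_boot all_order all_algebra.
From mathcomp Require Import all_classical all_reals all_analysis.
From mathcomp Require Import perm complex ring lra.

Import Order.TTheory GRing.Theory Num.Theory.
Import numFieldNormedType.Exports.
Local Open Scope ring_scope.

Set Implicit Arguments.
Unset Strict Implicit.
Unset Printing Implicit Defensive.

(** * Invariance of the spectrum under similarity *)

Section Similarity.
Variables (K : numFieldType) (V : normedModType K).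

(** Conjugation turns the inverse [S] for [T] into [U \o S \o U'] for [T']; continuity of [U] and
    [U'] keeps it bounded. *)
Lemma resolvent_set_similar (T T' U U' : {linear V -> V}) :
    continuous U -> continuous U' -> cancel U U' -> cancel U' U ->
    (forall v, T' (U v) = U (T v)) ->
  (resolvent_set T `<=` resolvent_set T')%classic.
Proof.
move=> cU cU' UK U'K TU l [S [cS Sl Sr]].
exists (U \o S \o U' : {linear V -> V}); split=> [v|v|v] /=.
- apply: continuous_comp; first exact: cU'.
  by apply: continuous_comp; [exact: cS | exact: cU].
- by rewrite -{1 2}(U'K v) TU -linearZ -linearB UK Sl U'K.
- by rewrite TU -linearZ -linearB Sr U'K.
Qed.

Lemma spectrum_similar (T T' U U' : {linear V -> V}) :
    continuous U -> continuous U' -> cancel U U' -> cancel U' U ->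
    (forall v, T' (U v) = U (T v)) ->
  spectrum T = spectrum T'.
Proof.
move=> cU cU' UK U'K TU; congr (~` _)%classic; apply/seteqP; split.
  exact: (resolvent_set_similar cU cU').
apply: (resolvent_set_similar cU' cU) => // v.
by apply: (can_inj UK); rewrite -TU !U'K.
Qed.

End Similarity.

(** * Unitary weighted permutations of coordinates *)

Section WeightedPermutation.
Variables (R : realType) (I : choiceType) (u : I -> R[i]) (s : I -> I).
Hypotheses (bs : bijective s) (u1 : forall i, sqmod (u i) = 1).

Definition wperm (v : l2 R I) : l2 R I := MkL2 (reindex_subproof v bs u1).

Lemma wperm_linear : linear wperm.
Proof.
by move=> c v w; apply: l2_ext => i; rewrite l2D l2Z /= mulrDr mulrCA.
Qed.

HB.instance Definition _ :=
  GRing.isLinear.Build R[i] (l2 R I) (l2 R I) _ wperm wperm_linear.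

Lemma norm_wperm v : `|wperm v| = `|v|.
Proof. by rewrite !l2_normE /l2norm /= sumsq_reindex. Qed.

Lemma wperm_continuous : continuous wperm.
Proof.
(* For an isometry, delta can be taken equal to epsilon. *)
move=> v; apply/(cvgrPdist_lt (FF := nbhs_filter v)) => e e0; apply/nbhs_normP; exists e => //= w.
by rewrite /ball_ /= -linearB norm_wperm.
Qed.

End WeightedPermutation.

(** The inverse of a weighted permutation is one too, with permutation $t=s^{-1}$ and weight
    $u(t(i))^{-1}$, so an intertwining relation checked coordinate by coordinate suffices. *)
Lemma spectrum_wperm (R : realType) (I : choiceType) (u : I -> R[i])
    (s : I -> I) (T T' : {linear l2 R I -> l2 R I})
    (bs : bijective s) (u1 : forall i, sqmod (u i) = 1) :
    (forall v i, T' (wperm bs u1 v) i = u i * T v (s i)) ->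
  spectrum T = spectrum T'.
Proof.
move=> TU; have [t sK tK] := bs.
have bt : bijective t by exists s.
have uV i : (u i)^-1 * u i = 1.
  by rewrite mulVf//; apply/eqP => ui0; have /eqP := u1 i;
    rewrite ui0 sqmod0 eq_sym oner_eq0.
have w1 i : sqmod ((u (t i))^-1) = 1.
  by have := congr1 (@sqmod R) (uV (t i)); rewrite sqmodM u1 mulr1 sqmod1.
apply: (@spectrum_similar _ _ T T' (wperm bs u1) (wperm bt w1)).
- exact: wperm_continuous.
- exact: wperm_continuous.
- by move=> v; apply: l2_ext => i /=; rewrite mulrA uV mul1r tK.
- by move=> v; apply: l2_ext => i /=; rewrite sK mulrA [u i * _]mulrC uV mul1r.
- by move=> v; apply: l2_ext => i; rewrite TU.
Qed.

(** * Phases, and the rows of [Q] in coordinates *)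

Section Symmetries.
Variable R : realType.
Local Notation H3 := (l2 R ((int * int) * 'I_3)%type).
Local Notation o0 := (@Ordinal 3 0 isT).
Local Notation o1 := (@Ordinal 3 1 isT).
Local Notation o2 := (@Ordinal 3 2 isT).

Lemma ord3P (P : 'I_3 -> Prop) : P o0 -> P o1 -> P o2 -> forall j, P j.
Proof.
move=> P0 P1 P2 [[|[|[|//]]] lt3].
- by rewrite (_ : Ordinal _ = o0)//; exact: val_inj.
- by rewrite (_ : Ordinal _ = o1)//; exact: val_inj.
- by rewrite (_ : Ordinal _ = o2)//; exact: val_inj.
Qed.

Lemma expiD (s t : R) : expi (s + t) = expi s * expi t.
Proof.
by rewrite /expi cosD sinD; apply/eqP; rewrite eq_complex /=; apply/andP; split;
  apply/eqP; ring.
Qed.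

Lemma expi0 : expi (0 : R) = 1.
Proof. by rewrite /expi cos0 sin0. Qed.

Lemma expi_neq0 (t : R) : expi t != 0.
Proof.
apply/eqP => t0; have := sqmod_expi t.
by move/eqP; rewrite t0 sqmod0 eq_sym oner_eq0.
Qed.

Lemma expiN (t : R) : expi (- t) = (expi t)^-1.
Proof.
by apply: (mulfI (expi_neq0 t)); rewrite -expiD subrr expi0 mulfV ?expi_neq0.
Qed.

Lemma expi_pi : expi (pi : R) = -1.
Proof.
by rewrite /expi cospi sinpi; apply/eqP; rewrite eq_complex /= oppr0 !eqxx.
Qed.

Lemma expiM_int (t : R) (n : int) : expi (t * n%:~R) = expi t ^ n.
Proof.
have nat_case k : expi (t * k%:R) = expi t ^+ k.
  elim: k => [|k IH]; first by rewrite mulr0 expi0.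
  by rewrite -natr1 mulrDr mulr1 expiD IH exprSr.
case: n => k; first exact: nat_case.
by rewrite NegzE mulrNz mulrN expiN nat_case -exprnN.
Qed.

Lemma opmx3E (A : 'M[l2 R (int * int)%type -> l2 R (int * int)%type]_3)
    (v : H3) x j :
  opmx A v (x, j) =
    A j o0 (component o0 v) x + A j o1 (component o1 v) x
    + A j o2 (component o2 v) x.
Proof.
rewrite /opmx /= !big_ord_recl big_ord0 /= addr0 addrA.
by do 2?[congr (_ + _)]; congr (A j _ (component _ v) x); apply: val_inj.
Qed.

Section Rows.
Variables (g w : R) (v : H3) (a b : int).
Local Notation p := (expi (w + g / 8)).
Local Notation h := (expi (g / 2)).
Local Notation A := (expi (g * a%:~R)).

(** In $\tau_1^*\tau_2$ the phase of $\tau_2$ is read at $a+1$; the factor $e^{-i\gamma/2}$ moves it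
    to the midpoint $a+1/2$. In [expi_back], likewise, $a-1$ becomes $a-1/2$. *)
Let expi_step : expi (- (g / 2)) * expi (g * (a + 1)%:~R) = h * A.
Proof. by rewrite -!expiD; congr expi; rewrite intrD; field. Qed.

Let expi_back : expi (- (g / 2)) * expi (- (g * (a - 1)%:~R)) = h / A.
Proof. by rewrite -expiN -!expiD; congr expi; rewrite intrD; field. Qed.

(** In each row the coefficients are Laurent monomials in [p], [h], [A], so that [field] can compare
    two operators. *)
Lemma Q_row0 : Q g w v ((a, b), o0) =
  p * (v ((a + 1, b), o1) + h * A * v ((a + 1, b - 1), o1))
  + p^-1 * (v ((a + 1, b), o2) + A^-1 * v ((a, b + 1), o2)).
Proof.
rewrite [LHS](opmx3E (Qmx g w) v (a, b) o0) !mxE -!expiN -expi_step -mulrA.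
(* Up to computation, only the zero diagonal entry remains to be removed. *)
exact: (congr1 (fun z => z + _) (add0r _)).
Qed.

Lemma Q_row1 : Q g w v ((a, b), o1) =
  p^-1 * (v ((a - 1, b), o0) + h / A * v ((a - 1, b + 1), o0))
  + p * (h / A * v ((a - 1, b + 1), o2) + A^-1 * v ((a, b + 1), o2)).
Proof.
rewrite [LHS](opmx3E (Qmx g w) v (a, b) o1) !mxE -expi_back -!expiN -!mulrA.
exact: (congr1 (fun z => z + _) (addr0 _)).
Qed.

Lemma Q_row2 : Q g w v ((a, b), o2) =
  p * (v ((a - 1, b), o0) + A * v ((a, b - 1), o0))
  + p^-1 * (h * A * v ((a + 1, b - 1), o1) + A * v ((a, b - 1), o1)).
Proof.
rewrite [LHS](opmx3E (Qmx g w) v (a, b) o2) !mxE -expi_step -!expiN -!mulrA.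
exact: addr0.
Qed.

End Rows.

(** * The two symmetries of the spectrum *)

Lemma sigma_shift (g w : R) : sigma g (w + pi / 4) = sigma (g - 6 * pi) w.
Proof.
pose u (x : (int * int) * 'I_3) := expi (pi * (x.1.1 + x.1.2)%:~R) : R[i].
have u1 x : sqmod (u x) = 1 by exact: sqmod_expi.
have bs : bijective (@id ((int * int) * 'I_3)) by exists id.
apply: (spectrum_wperm (bs := bs) (u1 := u1)) => v [[a b] j].
have expi_6pi : expi (6 * pi : R) = 1.
  by rewrite -[6]/(6%:~R) mulrC expiM_int expi_pi; ring.
have hA : expi ((g - 6 * pi) * a%:~R) = expi (g * a%:~R).
  by rewrite !expiM_int expiD expiN expi_6pi invr1 mulr1.
have hh : expi ((g - 6 * pi) / 2) = - expi (g / 2).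
  rewrite (_ : _ / 2 = g / 2 - pi * 3%:~R); last by field.
  by rewrite expiD expiN expiM_int expi_pi; field.
have hp : expi (w + pi / 4 + g / 8) = - expi (w + (g - 6 * pi) / 8).
  rewrite (_ : _ + g / 8 = w + (g - 6 * pi) / 8 + pi); last by field.
  by rewrite expiD expi_pi mulrN1.
(* Terms without [h] change $a+b$ by one, so the sign of [u] cancels that of [p]; terms with [h]
   preserve $a+b$, and the signs of [p] and [h] cancel. *)
elim/ord3P: j; rewrite ?(Q_row0, Q_row1, Q_row2) /= /u /= hA hh hp
  !intrD !mulrDr !expiD !mulr1 ?mulrN1 ?expiN ?expi_pi; field;
  rewrite ?expi_neq0 //.
Qed.

Lemma sigma_flip (g w : R) : sigma g (- w) = sigma (- g) w.
Proof.
pose u (x : (int * int) * 'I_3) := expi (g * x.1.1%:~R ^+ 2 / 2) : R[i].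
have u1 x : sqmod (u x) = 1 by exact: sqmod_expi.
pose s (x : (int * int) * 'I_3) := ((- x.1.1, x.1.1 + x.1.2), tperm o0 o1 x.2).
have sK : involutive s.
  by move=> [[a b] j]; rewrite /s /= opprK tpermK addrA addNr add0r.
have bs : bijective s by exists s.
apply: (spectrum_wperm (bs := bs) (u1 := u1)) => v [[a b] j].
have hA : expi (- g * a%:~R) = (expi (g * a%:~R))^-1 by rewrite mulNr expiN.
have hA' : expi (g * (- a)%:~R) = (expi (g * a%:~R))^-1.
  by rewrite mulrNz mulrN expiN.
have hh : expi (- g / 2) = (expi (g / 2))^-1 by rewrite mulNr expiN.
have hp : expi (w + - g / 8) = (expi (- w + g / 8))^-1.
  by rewrite -expiN; congr expi; field.
(* Since $(a\pm1)^2/2=a^2/2\pm a+1/2$, a step in $a$ multiplies the weight by exactly the monomial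
   needed to exchange the reflected bonds. *)
have hu1 : expi (g * (a + 1)%:~R ^+ 2 / 2)
    = expi (g * a%:~R ^+ 2 / 2) * expi (g * a%:~R) * expi (g / 2).
  by rewrite -!expiD; congr expi; rewrite intrD; field.
have hu2 : expi (g * (a - 1)%:~R ^+ 2 / 2)
    = expi (g * a%:~R ^+ 2 / 2) / expi (g * a%:~R) * expi (g / 2).
  by rewrite -expiN -!expiD; congr expi; rewrite intrD; field.
(* Reflected neighbours get one normal form, so that both sides involve the same values of [v]. *)
have x1 : - (a + 1) = - a - 1 by ring.
have x2 : - (a - 1) = - a + 1 by ring.
have y1 : a + 1 + b = a + b + 1 by ring.
have y2 : a - 1 + b = a + b - 1 by ring.
have y3 : a + 1 + (b - 1) = a + b by ring.
have y4 : a - 1 + (b + 1) = a + b by ring.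
have idx := (x1, x2, y1, y2, y3, y4, addrA a b).
elim/ord3P: j; rewrite ?(Q_row0, Q_row1, Q_row2) /= /u /s /=
  ?(tpermL, tpermR) ?tpermD //.
- rewrite [X in _ = _ * X](Q_row1 g (- w) v (- a) (a + b)).
  by rewrite !idx hA hA' hh hp hu1; field; rewrite !expi_neq0.
- rewrite [X in _ = _ * X](Q_row0 g (- w) v (- a) (a + b)).
  by rewrite !idx hA hA' hh hp hu2; field; rewrite !expi_neq0.
- rewrite [X in _ = _ * X](Q_row2 g (- w) v (- a) (a + b)).
  by rewrite !idx hA hA' hh hp hu1 hu2; field; rewrite !expi_neq0.
Qed.

(** * Reduction of $\omega$ to $[0,\pi/8]$ *)

Lemma sigma_shift_int (n : int) (g w : R) :
  sigma g (w + n%:~R * (pi / 4)) = sigma (g - n%:~R * (6 * pi)) w.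
Proof.
have shift_nat (k : nat) (g' w' : R) :
    sigma g' (w' + k%:R * (pi / 4)) = sigma (g' - k%:R * (6 * pi)) w'.
  elim: k g' w' => [|k IH] g' w'; first by rewrite !mul0r addr0 subr0.
  rewrite (_ : w' + _ = w' + k%:R * (pi / 4) + pi / 4); last first.
    by rewrite -natr1; ring.
  rewrite sigma_shift IH (_ : _ - _ - _ = g' - k.+1%:R * (6 * pi))//.
  by rewrite -natr1; ring.
case: n => k; first exact: (shift_nat k g w).
(* For negative [n], the natural shift is used backwards, starting from $\gamma+6\pi(k+1)$. *)
rewrite NegzE mulrNz -[g in LHS](addrK (k.+1%:R * (6 * pi))).
rewrite -shift_nat (_ : w + _ + _ = w); last by rewrite mulNr subrK.
by rewrite (_ : _ - _ = g + k.+1%:R * (6 * pi)) // mulNr opprK.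
Qed.

Lemma sigma_fundamental_domain (g w : R) : exists g' w' : R,
  (0 <= w' <= pi / 8) /\ sigma g w = sigma g' w'.
Proof.
have pi4 : 0 < pi / 4 :> R by rewrite divr_gt0 ?pi_gt0.
(* Rounding to a nearest integer leaves a remainder of at most half of $\pi/4$. *)
pose n := Num.floor (w / (pi / 4) + 2^-1).
pose r := w - n%:~R * (pi / 4).
have sr : sigma g w = sigma (g - n%:~R * (6 * pi)) r.
  by rewrite -sigma_shift_int /r subrK.
have /andP[r1 r2] : - (pi / 8) <= r <= pi / 8.
  have := floor_itv (w / (pi / 4) + 2^-1).
  rewrite -/n intrD => /andP[n1 n2].
  have -> : r = (w / (pi / 4) - n%:~R) * (pi / 4).
    by rewrite mulrBl divfK ?gt_eqF.
  have -> : pi / 8 = 2^-1 * (pi / 4) :> R by field.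
  by rewrite -mulNr !ler_pM2r//; apply/andP; split; lra.
have [r0|r0] := leP 0 r.
  by exists (g - n%:~R * (6 * pi)), r; rewrite r0 r2.
exists (- (g - n%:~R * (6 * pi))), (- r); split.
  by rewrite oppr_ge0 ltW//= lerNl.
by rewrite -sigma_flip opprK.
Qed.

End Symmetries.

Unset Implicit Arguments.

Theorem proposition1p8 (R : realType) :
  [/\ forall g w : R, sigma g (w + pi / 4) = sigma (g - 6 * pi) w,
      forall g w : R, sigma g (- w) = sigma (- g) w &
      forall g w : R, exists g' w' : R,
        (0 <= w' <= pi / 8) /\ sigma g w = sigma g' w'].
Proof.
split; [exact: sigma_shift | exact: sigma_flip | exact: sigma_fundamental_domain].
Qed.
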